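(* Let $f:X\to Y$ and $g:Y\to Z$ be continuous maps such that $Y$ is a contractible space and $Z$ is path connected. Then $(f,g)$ is an $\mathcal{E}$-strict-functor pair, i.e. $\mathcal{E}(g)\copyright\mathcal{E}(f)=\mathcal{E}(g\circ f)$.
   Context: Homotopies are free (no base points). $\mathcal{E}(X)$ is the group, under composition, of homotopy classes of homotopy self-equivalences of a space $X$. For a continuous map $f:X\to Y$, $\mathcal{E}(f):=\{([h_X],[h_Y])\in\mathcal{E}(X)\times\mathcal{E}(Y)\mid f\circ h_X\simeq h_Y\circ f\}$. For subgroups $S\subset G\times F$ and $S'\subset F\times K$, $S'\copyright S:=\{(a,c)\in G\times K\mid \exists b\in F,\ (a,b)\in S,\ (b,c)\in S'\}$. The pair $(f,g)$ is called an $\mathcal{E}$-strict-functor pair if $\mathcal{E}(g)\copyright\mathcal{E}(f)=\mathcal{E}(g\circ f)$. *)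

(* Defs.v *)
From HB Require Import structures.
From mathcomp Require Import all_boot all_order all_algebra.
From mathcomp Require Import generic_quotient.
From mathcomp Require Import all_classical all_reals all_analysis.
From mathcomp Require Import homotopy.

Set Implicit Arguments.
Unset Strict Implicit.
Unset Printing Implicit Defensive.

Import Order.TTheory GRing.Theory Num.Theory.
Import numFieldNormedType.Exports.

Local Open Scope classical_set_scope.
Local Open Scope ring_scope.

Section unit_interval.
Variable R : realType.

Definition unit_interval : Type := set_type (`[0, 1]%classic : set R).

HB.instance Definition _ := Topological.copy unit_interval
  (set_type (`[0, 1]%classic : set R)).

Fact ui_zero_subproof : (0 : R) \in (`[0, 1]%classic : set R).
Proof. by rewrite inE /= in_itv /= lexx ler01. Qed.

Fact ui_one_subproof : (1 : R) \in (`[0, 1]%classic : set R).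
Proof. by rewrite inE /= in_itv /= lexx ler01. Qed.

Definition ui_zero : unit_interval := exist _ 0 ui_zero_subproof.
Definition ui_one : unit_interval := exist _ 1 ui_one_subproof.

Fact ui_zero_one_neq : ui_zero != ui_one.
Proof. by apply/eqP => -[] /eqP; rewrite eq_sym oner_eq0. Qed.

HB.instance Definition _ := isBiPointed.Build unit_interval ui_zero_one_neq.

Definition ui_val (t : unit_interval) : R := \val t.

Fact clamp_subproof (t : R) :
  Num.max 0 (Num.min 1 t) \in (`[0, 1]%classic : set R).
Proof. by rewrite inE /= in_itv /= le_max lexx ge_max ler01 ge_min lexx. Qed.

Definition clamp (t : R) : unit_interval :=
  exist _ (Num.max 0 (Num.min 1 t)) (clamp_subproof t).

Lemma clampE (t : unit_interval) (s : R) : s = ui_val t -> clamp s = t.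
Proof.
case: t => [t t01] -> ; apply: val_inj; rewrite /ui_val /=.
move: t01; rewrite inE /= in_itv /= => /andP[t0 t1].
by rewrite (min_idPr t1) (max_idPr t0).
Qed.

Lemma ui_val_continuous : continuous ui_val.
Proof. exact: initial_continuous. Qed.

Lemma clamp_continuous : continuous clamp.
Proof.
apply: continuous_comp_initial => t.
apply: (@continuous_max R R (fun=> 0) (fun t => Num.min 1 t)).
  exact: cvg_cst.
apply: (@continuous_min R R (fun=> 1) id); first exact: cvg_cst.
exact: cvg_id.
Qed.

End unit_interval.

Section continuity.
Context {T U V : topologicalType}.

Lemma continuous_compf (a : T -> U) (b : U -> V) :
  continuous a -> continuous b -> continuous (fun t => b (a t)).
Proof. by move=> ca cb t; apply: continuous_comp; [exact: ca | exact: cb]. Qed.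

Lemma continuous_pairf (a : T -> U) (b : T -> V) :
  continuous a -> continuous b -> continuous (fun t => (a t, b t)).
Proof. by move=> ca cb t; apply: cvg_pair; [exact: ca | exact: cb]. Qed.

End continuity.

Section homotopy.
Variable R : realType.
Local Notation I := (unit_interval R).

(* Free homotopy.  f and g need not be assumed continuous: this follows from
   the continuity of H. *)
Definition homotopic (X Y : topologicalType) (f g : X -> Y) : Prop :=
  exists H : X * I -> Y,
    [/\ continuous H, forall x, H (x, zero) = f x & forall x, H (x, one) = g x].

Definition homotopy_equivalence (X Y : topologicalType)
    (f : continuousType X Y) : Prop :=
  exists g : continuousType Y X,
    homotopic (g \o f) idfun /\ homotopic (f \o g) idfun.

(* In particular a contractible space is nonempty. *)
Definition contractible (X : topologicalType) : Prop :=
  exists x0 : X, homotopic (@idfun X) (cst x0).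

(* Nonemptiness is not required. *)
Definition path_connected (X : topologicalType) : Prop :=
  forall x y : X, inhabited {path I from x to y}.

Section homotopic_theory.
Context {X Y Z : topologicalType}.

Lemma homotopic_refl (f : continuousType X Y) : homotopic f f.
Proof.
exists (fun p => f p.1); split=> // p.
by apply: continuous_comp; [exact: cvg_fst | exact: cts_fun].
Qed.

Lemma homotopic_reparam (H : X * I -> Y) (phi : R -> R) :
  continuous H -> continuous phi ->
  continuous (fun p : X * I => H (p.1, clamp (phi (ui_val p.2)))).
Proof.
move=> cH cphi; apply: continuous_compf cH; apply: continuous_pairf => [p|].
  exact: cvg_fst.
apply: continuous_compf (@clamp_continuous R); apply: continuous_compf cphi.
apply: continuous_compf (@ui_val_continuous R) => p; exact: cvg_snd.
Qed.

Lemma homotopic_sym (f g : X -> Y) : homotopic f g -> homotopic g f.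
Proof.
move=> [H [cH H0 H1]]; exists (fun p => H (p.1, clamp (1 - ui_val p.2))); split.
- apply: (@homotopic_reparam H (fun t => 1 - t)) => // t.
  by apply: cvgB; [exact: cvg_cst | exact: cvg_id].
- by move=> x /=; rewrite (clampE (t := one)) // /ui_val /= subr0.
- by move=> x /=; rewrite (clampE (t := zero)) // /ui_val /= subrr.
Qed.

Lemma homotopic_trans (f g h : X -> Y) :
  homotopic f g -> homotopic g h -> homotopic f h.
Proof.
move=> [H [cH H0 H1]] [K [cK K0 K1]].
pose H' p := H (p.1, clamp (2 * ui_val p.2)).
pose K' p := K (p.1, clamp (2 * ui_val p.2 - 1)).
have cH' : continuous H'.
  apply: (@homotopic_reparam H (fun t => 2 * t)) => // t.
  by apply: cvgM; [exact: cvg_cst | exact: cvg_id].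
have cK' : continuous K'.
  apply: (@homotopic_reparam K (fun t => 2 * t - 1)) => // t.
  apply: cvgB; last exact: cvg_cst.
  by apply: cvgM; [exact: cvg_cst | exact: cvg_id].
have cval : continuous (fun p : X * I => ui_val p.2).
  by apply: continuous_compf (@ui_val_continuous R) => p; exact: cvg_snd.
pose L p := if ui_val p.2 <= 2^-1 then H' p else K' p.
pose A := [set p : X * I | ui_val p.2 <= 2^-1].
pose B := [set p : X * I | 2^-1 <= ui_val p.2].
have cA : closed A.
  apply: (@preimage_closed _ _ (fun p : X * I => ui_val p.2) [set t : R | t <= 2^-1]).
    by move=> p _; exact: cval.
  exact: closed_le.
have cB : closed B.
  apply: (@preimage_closed _ _ (fun p : X * I => ui_val p.2) [set t : R | 2^-1 <= t]).
    by move=> p _; exact: cval.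
  exact: closed_ge.
have AB : A `|` B = setT.
  by apply/seteqP; split=> // p _; case: (leP (ui_val p.2) 2^-1) => [|/ltW]; [left | right].
exists L; split.
- apply/continuous_subspace_setT; rewrite -AB; apply: withinU_continuous => //.
  + apply: (@subspace_eq_continuous _ A _ H'); last exact: continuous_subspaceT.
    by move=> p; rewrite inE /A /= /from_subspace /L => ->.
  + apply: (@subspace_eq_continuous _ B _ K'); last exact: continuous_subspaceT.
    move=> p; rewrite inE /B /= /from_subspace /L => p1.
    case: ifPn => // p2; have p3 : ui_val p.2 = 2^-1 by apply/eqP; rewrite eq_le p2 p1.
    rewrite /H' /K' p3 divff ?pnatr_eq0// subrr.
    by rewrite (clampE (t := one) (s := 1)) // (clampE (t := zero) (s := 0)) // H1 K0.
- move=> x; rewrite /L /= ifT ?invr_ge0 ?ler0n// /H' /=.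
  by rewrite (clampE (t := zero)) // /ui_val /= mulr0.
- move=> x; rewrite /L /= ifF; last first.
    by apply/negbTE; rewrite -ltNge invf_lt1 ?ltr0n// ltr1n.
  by rewrite /K' /= (clampE (t := one)) // /ui_val /= mulr1 -[2]/(1 + 1) addrK.
Qed.

Lemma homotopic_compl (f g : X -> Y) (k : continuousType Y Z) :
  homotopic f g -> homotopic (k \o f) (k \o g).
Proof.
move=> [H [cH H0 H1]]; exists (k \o H); split=> [p|x|x] /=; rewrite ?H0 ?H1//.
by apply: continuous_comp; [exact: cH | exact: cts_fun].
Qed.

Lemma homotopic_compr (f g : Y -> Z) (k : continuousType X Y) :
  homotopic f g -> homotopic (f \o k) (g \o k).
Proof.
move=> [H [cH H0 H1]]; exists (fun p => H (k p.1, p.2)).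
split=> [p|x|x] /=; rewrite ?H0 ?H1//.
move: p; apply: continuous_compf cH; apply: continuous_pairf => [|p].
  by move=> p; apply: continuous_comp; [exact: cvg_fst | exact: cts_fun].
exact: cvg_snd.
Qed.

End homotopic_theory.

Section self_equivalence.
Variable X : topologicalType.

Definition self_equiv : Type :=
  {h : continuousType X X | `[< homotopy_equivalence h >]}.

HB.instance Definition _ := Choice.on self_equiv.

Definition se_fun (h : self_equiv) : continuousType X X := \val h.

Definition mk_self_equiv (h : continuousType X X)
  (hh : homotopy_equivalence h) : self_equiv := exist _ h (asboolT hh).

Definition se_homotopic (h k : self_equiv) : bool :=
  `[< homotopic (se_fun h) (se_fun k) >].

Fact se_homotopic_refl : reflexive se_homotopic.
Proof. by move=> h; apply/asboolP; exact: homotopic_refl. Qed.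

Fact se_homotopic_sym : symmetric se_homotopic.
Proof. by move=> h k; apply/asboolP/asboolP; exact: homotopic_sym. Qed.

Fact se_homotopic_trans : transitive se_homotopic.
Proof.
move=> k h l /asboolP hk /asboolP kl; apply/asboolP; exact: homotopic_trans kl.
Qed.

Canonical se_homotopic_equiv := EquivRel se_homotopic
  se_homotopic_refl se_homotopic_sym se_homotopic_trans.

(* The group E(X), with product [h] * [k] = [h \o k]. *)
Definition self_equiv_group : Type := {eq_quot se_homotopic}%qT.

HB.instance Definition _ := EqQuotient.on self_equiv_group.
HB.instance Definition _ := Choice.on self_equiv_group.

Definition hclass (h : self_equiv) : self_equiv_group := \pi_self_equiv_group%qT h.

Lemma hclassP (h k : self_equiv) :
  hclass h = hclass k <-> homotopic (se_fun h) (se_fun k).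
Proof.
by split=> [/eqquotP/asboolP//|hk]; apply/eqquotP/asboolP.
Qed.

Lemma hclass_surj (a : self_equiv_group) : exists h, a = hclass h.
Proof. by exists (repr a); rewrite /hclass reprK. Qed.

Fact se_id_subproof : homotopy_equivalence (idfun : continuousType X X).
Proof. by exists idfun; split; exact: homotopic_refl. Qed.

Definition se_id : self_equiv := mk_self_equiv se_id_subproof.

Fact se_comp_subproof (h k : self_equiv) :
  homotopy_equivalence (se_fun h \o se_fun k : continuousType X X).
Proof.
have /asboolP[h' [h'h hh']] := valP h.
have /asboolP[k' [k'k kk']] := valP k.
exists (k' \o h' : continuousType X X); split.
- apply: homotopic_trans k'k.
  exact: (homotopic_compl k' (homotopic_compr (se_fun k) h'h)).
- apply: homotopic_trans hh'.
  exact: (homotopic_compl (se_fun h) (homotopic_compr h' kk')).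
Qed.

Definition se_comp (h k : self_equiv) : self_equiv :=
  mk_self_equiv (se_comp_subproof h k).

Fact se_inv_subproof (h : self_equiv) : exists k : self_equiv,
  homotopic (se_fun k \o se_fun h) idfun /\
  homotopic (se_fun h \o se_fun k) idfun.
Proof.
have /asboolP[k [kh hk]] := valP h.
have kE : homotopy_equivalence k by exists (se_fun h).
by exists (mk_self_equiv kE).
Qed.

Definition se_inv (h : self_equiv) : self_equiv :=
  projT1 (cid (se_inv_subproof h)).

Lemma se_invP (h : self_equiv) :
  homotopic (se_fun (se_inv h) \o se_fun h) idfun /\
  homotopic (se_fun h \o se_fun (se_inv h)) idfun.
Proof. exact: (projT2 (cid (se_inv_subproof h))). Qed.

Definition seg_one : self_equiv_group := hclass se_id.

Definition seg_mul (a b : self_equiv_group) : self_equiv_group :=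
  hclass (se_comp (repr a) (repr b)).

Definition seg_inv (a : self_equiv_group) : self_equiv_group :=
  hclass (se_inv (repr a)).

Lemma homotopic_repr (h : self_equiv) :
  homotopic (se_fun (repr (hclass h))) (se_fun h).
Proof. by apply/hclassP; rewrite /hclass reprK. Qed.

Lemma hclass_comp (h k : self_equiv) :
  seg_mul (hclass h) (hclass k) = hclass (se_comp h k).
Proof.
apply/hclassP.
apply: homotopic_trans (homotopic_compr (se_fun k) (homotopic_repr h)).
exact: homotopic_compl (homotopic_repr k).
Qed.

Fact seg_mulA : associative seg_mul.
Proof.
move=> a b c; have [h ->] := hclass_surj a; have [k ->] := hclass_surj b.
have [l ->] := hclass_surj c; rewrite !hclass_comp; apply/hclassP.
exact: homotopic_refl.
Qed.

Fact seg_mul1 : left_id seg_one seg_mul.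
Proof.
move=> a; have [h ->] := hclass_surj a; rewrite hclass_comp; apply/hclassP.
exact: homotopic_refl.
Qed.

Fact seg_mulr1 : right_id seg_one seg_mul.
Proof.
move=> a; have [h ->] := hclass_surj a; rewrite hclass_comp; apply/hclassP.
exact: homotopic_refl.
Qed.

Fact seg_mulV : left_inverse seg_one seg_inv seg_mul.
Proof.
move=> a; rewrite -[X in seg_mul _ X]reprK hclass_comp; apply/hclassP.
by have [] := se_invP (repr a).
Qed.

Fact seg_mulrV : right_inverse seg_one seg_inv seg_mul.
Proof.
move=> a; rewrite -[X in seg_mul X _]reprK hclass_comp; apply/hclassP.
by have [] := se_invP (repr a).
Qed.

HB.instance Definition _ := isGroup.Build self_equiv_group
  seg_mulA seg_mul1 seg_mulr1 seg_mulV seg_mulrV.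

End self_equivalence.

(* The subset E(f) of E(X) x E(Y); it is a subgroup by self_equiv_rel_subgroup
   below. *)
Definition self_equiv_rel (X Y : topologicalType) (f : continuousType X Y) :
    set (self_equiv_group X * self_equiv_group Y) :=
  [set ab | exists (hX : self_equiv X) (hY : self_equiv Y),
    ab = (hclass hX, hclass hY) /\
    homotopic (f \o se_fun hX) (se_fun hY \o f)].

End homotopy.

Arguments self_equiv_rel R {X Y} f.

Section correspondence.
Local Open Scope group_scope.

(* Subgroups of a direct product, for which there is no groupType instance. *)
Definition subgroup2 (G F : groupType) (S : set (G * F)) : Prop :=
  [/\ S (1, 1),
      forall a b, S a -> S b -> S (a.1 * b.1, a.2 * b.2) &
      forall a, S a -> S (a.1^-1, a.2^-1)].

(* S' (c) S.  The formula makes sense for arbitrary subsets; corr_comp_subgroup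
   shows that it restricts to an operation on subgroups. *)
Definition corr_comp (G F K : groupType) (S' : set (F * K)) (S : set (G * F)) :
    set (G * K) :=
  [set ac | exists b : F, S (ac.1, b) /\ S' (b, ac.2)].

Lemma corr_comp_subgroup (G F K : groupType)
    (S' : set (F * K)) (S : set (G * F)) :
  subgroup2 S' -> subgroup2 S -> subgroup2 (corr_comp S' S).
Proof.
move=> [S'1 S'M S'V] [S1 SM SV]; split.
- by exists 1.
- move=> a b [c [? ?]] [d [? ?]]; exists (c * d); split.
    exact: (SM (a.1, c) (b.1, d)).
  exact: (S'M (c, a.2) (d, b.2)).
- move=> a [c [? ?]]; exists c^-1; split; first exact: (SV (a.1, c)).
  exact: (S'V (c, a.2)).
Qed.

Lemma self_equiv_rel_subgroup (R : realType) (X Y : topologicalType)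
  (f : continuousType X Y) : subgroup2 (self_equiv_rel R f).
Proof.
split.
- by exists (se_id R X), (se_id R Y); split=> //; exact: homotopic_refl.
- move=> _ _ [h [k [-> fh]]] [h' [k' [-> fh']]] /=.
  exists (se_comp h h'), (se_comp k k'); split.
    by congr pair; exact: hclass_comp.
  apply: homotopic_trans (homotopic_compl (se_fun k) fh').
  exact: homotopic_compr (se_fun h') fh.
- move=> _ [h0 [k0 [-> fh0]]] /=.
  set h := repr (hclass h0); set k := repr (hclass k0).
  exists (se_inv h), (se_inv k); split=> //.
  have fh : homotopic R (f \o se_fun h) (se_fun k \o f).
    apply: homotopic_trans (homotopic_compl f (homotopic_repr h0)) _.
    apply: homotopic_trans fh0 _.
    exact: homotopic_compr f (homotopic_sym (homotopic_repr k0)).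
  have [kk _] := se_invP k; have [_ hh] := se_invP h.
  have e1 := homotopic_compr (f \o se_fun (se_inv h)) kk.
  apply: homotopic_trans (homotopic_sym e1) _.
  have e2 := homotopic_compl (se_fun (se_inv k))
    (homotopic_compr (se_fun (se_inv h)) fh).
  apply: homotopic_trans (homotopic_sym e2) _.
  exact: (homotopic_compl (se_fun (se_inv k) \o f) hh).
Qed.

End correspondence.

Definition strict_functor_pair (R : realType) (X Y Z : topologicalType)
    (f : continuousType X Y) (g : continuousType Y Z) : Prop :=
  corr_comp (self_equiv_rel R g) (self_equiv_rel R f) =
  self_equiv_rel R (g \o f).
Arguments strict_functor_pair R {X Y Z} f g.

(* Main.v *)
Require Import Defs.
From mathcomp Require Import all_boot all_order all_algebra.
From mathcomp Require Import all_classical all_reals all_analysis.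
From mathcomp Require Import homotopy.

(** The correspondences $E(f)$, $E(g)$ and $E(g \circ f)$ are all the full products
    of the groups of self-equivalences, so that the two sides agree trivially.
    Indeed any two maps into the contractible space $Y$ are homotopic
    ([homotopic_into_contractible]), and so are any two maps from $Y$ to the
    path connected space $Z$ ([homotopic_from_contractible]): each is homotopic
    to a constant map, and a path in $Z$ joins the two constants. Hence
    $f \circ h_X \simeq h_Y \circ f$ and $g \circ h_Y \simeq h_Z \circ g$ for
    all choices of self-equivalences; the first square for $h_Y = id$, pasted
    with the second, gives $g \circ f \circ h_X \simeq h_Z \circ g \circ f$.
    A common element $b$ of $E(Y)$ always exists since $E(Y)$ contains the
    class of the identity. *)

Local Open Scope classical_set_scope.

(** A contraction of $Y$ to a point $y_0$ deforms every map into $Y$ to the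
    constant map at $y_0$, whatever its source. *)
Lemma homotopic_into_contractible (R : realType) (X Y : topologicalType)
    (Y_contractible : contractible R Y) (u v : continuousType X Y) :
  homotopic R u v.
Proof.
have [y0 idy0] := Y_contractible.
apply: homotopic_trans (homotopic_compr u idy0) _.
exact: homotopic_sym (homotopic_compr v idy0).
Qed.

(** A path from $z$ to $w$, read as a homotopy that ignores the point of $Y$. *)
Lemma homotopic_cst (R : realType) (Y Z : topologicalType)
    (Z_path_connected : path_connected R Z) (z w : Z) :
  homotopic R (@cst Y Z z) (@cst Y Z w).
Proof.
have [p] := Z_path_connected z w.
exists (fun q => p q.2); split=> [|y|y] /=.
- by apply: continuous_compf (@cts_fun _ _ p) => q; exact: cvg_snd.
- exact: path_zero.
- exact: path_one.
Qed.

Lemma homotopic_from_contractible (R : realType) (Y Z : topologicalType)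
    (Y_contractible : contractible R Y) (Z_path_connected : path_connected R Z)
    (u v : continuousType Y Z) :
  homotopic R u v.
Proof.
have [y0 idy0] := Y_contractible.
apply: homotopic_trans (homotopic_compl u idy0) _.
apply: homotopic_trans (homotopic_cst R Y Z Z_path_connected (u y0) (v y0)) _.
exact: homotopic_sym (homotopic_compl v idy0).
Qed.

Lemma self_equiv_rel_setT (R : realType) (X Y : topologicalType)
    (f : continuousType X Y)
    (commute : forall (hX : self_equiv R X) (hY : self_equiv R Y),
      homotopic R (f \o se_fun hX) (se_fun hY \o f)) :
  self_equiv_rel R f = [set: self_equiv_group R X * self_equiv_group R Y].
Proof.
apply/seteqP; split=> // -[a b] _.
have [hX ->] := hclass_surj a; have [hY ->] := hclass_surj b.
by exists hX, hY.
Qed.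

Theorem theorem5p8 (R : realType) (X Y Z : topologicalType)
    (f : continuousType X Y) (g : continuousType Y Z)
    (Y_contractible : contractible R Y) (Z_path_connected : path_connected R Z) :
  strict_functor_pair R f g.
Proof.
rewrite /strict_functor_pair !self_equiv_rel_setT.
- by apply/seteqP; split=> // -[a c] _; exists (seg_one R Y).
- move=> hX hZ.
  have f_hX : homotopic R (f \o se_fun hX) f.
    exact: homotopic_into_contractible.
  have g_hZ : homotopic R g (se_fun hZ \o g).
    exact: homotopic_from_contractible.
  apply: homotopic_trans (homotopic_compl g f_hX) _.
  exact: homotopic_compr f g_hZ.
- by move=> hX hY; exact: homotopic_into_contractible.
- by move=> hY hZ; exact: homotopic_from_contractible.
Qed.
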